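(* Let $k\in\mathbb{N}$, let $\phi_{*\tau}$ be a projected phase polynomial of degree $k$ on a finite abelian group $Z$, let $\delta>0$, and suppose that $f:Z\to\mathbb{C}$ satisfies $|\langle f,\phi_{*\tau}\rangle|\ge\delta$. Then $\|f\|_{U^{k+1}}\ge\delta$.
   Context: $\mathbb{E}$ denotes the average, and $\langle f,g\rangle=\mathbb{E}_{x\in Z}f(x)\overline{g(x)}$. $\|f\|_{U^{k+1}}^{2^{k+1}}=\mathbb{E}_{x,h_1,\dots,h_{k+1}\in Z}\prod_{v\in\{0,1\}^{k+1}}\mathcal{C}^{|v|}f(x+\sum_iv_ih_i)$, with $\mathcal{C}$ complex conjugation and $|v|=\sum_iv_i$. A map $P$ between abelian groups is polynomial of degree at most $k$ if $\partial_{h_1}\cdots\partial_{h_{k+1}}P$ vanishes identically for all $h_1,\dots,h_{k+1}$, where $\partial_hP(x)=P(x+h)-P(x)$. A polynomial phase function of degree at most $k$ on $Z'$ is a function $x\mapsto e^{2\pi iP(x)}$ with $P:Z'\to\mathbb{R}/\mathbb{Z}$ polynomial of degree at most $k$. A projected phase polynomial of degree $k$ on a finite abelian group $Z$ is a function $\phi_{*\tau}:Z\to\mathbb{C}$ of modulus at most 1 of the following form: there are a finite abelian group $Z'$, a surjective homomorphism $\tau:Z'\to Z$ and a polynomial phase function $\phi:Z'\to\mathbb{C}$ of degree at most $k$, such that $\phi_{*\tau}(x)=\mathbb{E}_{y\in\tau^{-1}(x)}\phi(y)$ for every $x\in Z$. *)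

(* Defs.v *)
From HB Require Import structures.
From mathcomp Require Import all_boot all_order all_algebra generic_quotient
  ring_quotient.
From mathcomp Require Import all_classical reals trigo.
From mathcomp Require Import complex.

Set Implicit Arguments.
Unset Strict Implicit.
Unset Printing Implicit Defensive.

Import Order.TTheory GRing.Theory Num.Theory.
Local Open Scope ring_scope.
Local Open Scope complex_scope.
Local Open Scope quotient_scope.

Section Averages.
Variable R : realType.

Definition avg (T : finType) (A : {set T}) (F : T -> R[i]) : R[i] :=
  (#|A|%:R)^-1 * \sum_(x in A) F x.

Definition inner (T : finType) (f g : T -> R[i]) : R[i] :=
  avg [set: T] (fun x => f x * Num.conj (g x)).

End Averages.

Section Gowers.
Variables (R : realType) (Z : finZmodType).

Definition gowers_avg (d : nat) (f : Z -> R[i]) : R[i] :=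
  avg [set: Z * {ffun 'I_d -> Z}] (fun xh =>
    \prod_(v : {ffun 'I_d -> bool})
      iter (\sum_i v i)%N Num.conj (f (xh.1 + \sum_i xh.2 i *+ v i))).

(* For d >= 1 the average is a nonnegative real, and n.-root is then its
   nonnegative real n-th root, viewed in R[i]. *)
Definition gowers_norm (d : nat) (f : Z -> R[i]) : R[i] :=
  (2 ^ d)%N.-root (gowers_avg d f).

End Gowers.

Section PolynomialMaps.
Variables (A B : zmodType).

Definition diff_op (h : A) (P : A -> B) : A -> B := fun x => P (x + h) - P x.

Definition polynomial_map (k : nat) (P : A -> B) : Prop :=
  forall (h : k.+1.-tuple A) (x : A), foldr diff_op P h x = 0.

End PolynomialMaps.

Section Circle.
Variable R : realType.

Definition int_pred : {pred R} := fun x => x \is a Num.int.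

Lemma int_pred_zmod_closed : zmod_closed int_pred.
Proof. by split=> [|x y]; [exact: rpred0 | exact: rpredB]. Qed.

HB.instance Definition _ := GRing.isZmodClosed.Build R int_pred
  int_pred_zmod_closed.

Definition circle := @Quotient.quot R int_pred.
HB.instance Definition _ := GRing.Zmodule.on circle.
HB.instance Definition _ := EqQuotient.on circle.

Definition circle_exp (t : circle) : R[i] :=
  let a : R := pi *+ 2 * repr t in
  cos a +i* sin a.

Lemma cos_sin_2piDint (a : R) (m : int) :
  cos (pi *+ 2 * (a + m%:~R)) = cos (pi *+ 2 * a) /\
  sin (pi *+ 2 * (a + m%:~R)) = sin (pi *+ 2 * a).
Proof.
have nat_case b (n : nat) : cos (pi *+ 2 * (b + n%:R)) = cos (pi *+ 2 * b) /\
    sin (pi *+ 2 * (b + n%:R)) = sin (pi *+ 2 * b) :> R.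
  by rewrite mulrDr mulr_natr (periodicn (@cosD2pi R)) (periodicn (@sinD2pi R)).
case: m => n; first exact: nat_case.
by have [] := nat_case (a + (Negz n)%:~R) n.+1; rewrite NegzE mulrNz addrNK.
Qed.

(* circle_exp does not depend on the representative chosen by repr. *)
Lemma circle_expE (a : R) :
  circle_exp (\pi_circle a) =
  cos (pi *+ 2 * a) +i* sin (pi *+ 2 * a).
Proof.
rewrite /circle_exp.
have /intrP[m am] : repr (\pi_circle a) - a \is a Num.int.
  have := Quotient.idealrBE (int_pred : zmodClosed R) (repr (\pi_circle a)) a.
  by rewrite reprK eqxx.
have [c s] := cos_sin_2piDint a m.
by rewrite -c -s -am addrC subrK.
Qed.

End Circle.

Definition polynomial_phase (R : realType) (A : zmodType) (k : nat)
    (phi : A -> R[i]) : Prop :=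
  exists2 P : A -> circle R,
    polynomial_map k P & phi = (fun x => circle_exp (P x)).

Definition projected_phase_polynomial (R : realType) (Z : finZmodType)
    (k : nat) (psi : Z -> R[i]) : Prop :=
  (forall x, `|psi x| <= 1) /\
  exists (Z' : finZmodType) (tau : {additive Z' -> Z}) (phi : Z' -> R[i]),
    [/\ forall x, exists y, tau y = x,
        polynomial_phase k phi &
        forall x, psi x = avg [set y | tau y == x] phi].

(* Main.v *)
Require Import Defs.
From mathcomp Require Import all_boot all_order all_algebra.
From mathcomp Require Import generic_quotient ring_quotient trigo.
From mathcomp Require Import reals complex.

Set Implicit Arguments.
Unset Strict Implicit.
Unset Printing Implicit Defensive.

Import Order.TTheory GRing.Theory Num.Theory.
Local Open Scope ring_scope.
Local Open Scope complex_scope.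

(** Pulling [f] back along [tau : Z' -> Z] turns [inner f psi] into the
    correlation on [Z'] of [f \o tau] with a genuine phase [e(P)].  Squaring,
    [|E g|^2 = E_h E_x g(x) g(x+h)^*] replaces [f] by its multiplicative
    derivative in direction [tau h] and [P] by an additive derivative, lowering
    its degree; convexity of [t |-> t^(2^d)] allows iterating this until the
    phase disappears.  Averages of functions of [tau h] over [Z'] are averages
    over [Z] because the fibers of [tau] have equal size. *)

Notation mean F := (avg [set: _] F).

Definition mul_deriv (R : realType) (A : zmodType) (h : A) (f : A -> R[i]) :=
  fun x : A => f x * Num.conj (f (x + h)).

(** * Averages over finite types: convexity and exchange of means *)

Section Means.
Variables (R : realType) (T : finType).
Implicit Types F G : T -> R[i].

Lemma meanE F : mean F = #|T|%:R^-1 * \sum_x F x.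
Proof. by rewrite /avg cardsT; congr (_ * _); apply: eq_bigl => x; rewrite inE. Qed.

Lemma eq_mean F G : F =1 G -> mean F = mean G.
Proof. by move=> eFG; rewrite !meanE; congr (_ * _); apply: eq_bigr. Qed.

Lemma ler_mean F G : (forall x, F x <= G x) -> mean F <= mean G.
Proof.
move=> leFG; rewrite !meanE ler_wpM2l ?invr_ge0 ?ler0n //.
by apply: ler_sum => x _; apply: leFG.
Qed.

Lemma mean_ge0 F : (forall x, 0 <= F x) -> 0 <= mean F.
Proof.
by move=> F0; rewrite meanE mulr_ge0 ?invr_ge0 ?ler0n // sumr_ge0.
Qed.

Lemma ler_norm_mean F : `|mean F| <= mean (fun x => `|F x|).
Proof.
rewrite !meanE normrM ger0_norm ?invr_ge0 ?ler0n //.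
by rewrite ler_wpM2l ?invr_ge0 ?ler0n // ler_norm_sum.
Qed.

Lemma conj_mean F : Num.conj (mean F) = mean (fun x => Num.conj (F x)).
Proof. by rewrite !meanE rmorphM rmorph_sum fmorphV rmorph_nat. Qed.

Lemma mean_mull (c : R[i]) F : c * mean F = mean (fun x => c * F x).
Proof. by rewrite !meanE mulrCA mulr_sumr. Qed.

Lemma mean_mulr (c : R[i]) F : mean F * c = mean (fun x => F x * c).
Proof. by rewrite mulrC mean_mull; apply: eq_mean => x; rewrite mulrC. Qed.

(** The variance, the mean of [(F x - mean F) ^+ 2], is nonnegative. *)
Lemma sqr_mean_le F :
  (forall x, 0 <= F x) -> mean F ^+ 2 <= mean (fun x => F x ^+ 2).
Proof.
move=> F0; have [T0 | Tpos] := posnP #|T|.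
  (* Over an empty type the inverse of 0 is 0, so both sides vanish. *)
  by rewrite !meanE T0 invr0 !mul0r expr0n.
have Tneq0 : #|T|%:R != 0 :> R[i] by rewrite pnatr_eq0 -lt0n.
(* The order on [R[i]] is partial, and a square is nonnegative there only for a real base. *)
have m_real : mean F \is Num.real by rewrite ger0_real ?mean_ge0.
have : 0 <= mean (fun x => (F x - mean F) ^+ 2).
  by apply: mean_ge0 => x; rewrite real_exprn_even_ge0 // rpredB // ger0_real.
suff -> : mean (fun x => (F x - mean F) ^+ 2) =
          mean (fun x => F x ^+ 2) - mean F ^+ 2 by rewrite subr_ge0.
set m := mean F; rewrite meanE.
under eq_bigr => x _ do rewrite sqrrB.
rewrite big_split sumrB /= sumr_const mulrDr mulrBr -meanE.
under eq_bigr => x _ do rewrite -mulrnAr.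
rewrite -mulr_suml mulrA -meanE -/m -[m ^+ 2 *+ _]mulr_natl.
rewrite mulKf // -addrA; congr (_ + _).
by rewrite mulrnAr -expr2 mulr2n opprD addrNK.
Qed.

(** Exponents that are powers of 2 need only the square case, iterated with [F] replaced by its
    square. *)
Lemma mean_expr2X_le n F :
  (forall x, 0 <= F x) -> mean F ^+ (2 ^ n) <= mean (fun x => F x ^+ (2 ^ n)).
Proof.
elim: n F => [|n IHn] F F0; first by rewrite expn0.
rewrite expnS exprM.
apply: (@le_trans _ _ (mean (fun x => F x ^+ 2) ^+ (2 ^ n))).
  rewrite lerXn2r ?sqr_mean_le // nnegrE ?exprn_ge0 ?mean_ge0 // => x.
  by rewrite exprn_ge0.
under [X in _ <= X]eq_mean => x do rewrite exprM.
by apply: IHn => x; rewrite exprn_ge0.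
Qed.

End Means.

Lemma mean_pair (R : realType) (S T : finType) (F : S * T -> R[i]) :
  mean F = mean (fun x => mean (fun y => F (x, y))).
Proof.
rewrite !meanE card_prod natrM invfM -mulrA; congr (_ * _).
under [in RHS]eq_bigr => x _ do rewrite meanE.
by rewrite -mulr_sumr pair_bigA; congr (_ * _); apply: eq_bigr => -[].
Qed.

Lemma mean_exchange (R : realType) (S T : finType) (F : S -> T -> R[i]) :
  mean (fun x => mean (F x)) = mean (fun y => mean (F^~ y)).
Proof.
rewrite !meanE.
under eq_bigr => x _ do rewrite meanE.
under [in RHS]eq_bigr => x _ do rewrite meanE.
by rewrite -!mulr_sumr mulrCA exchange_big.
Qed.

(** The square is a double mean of [f x * Num.conj (f y)]; substitute [y = x + h]. *)
Lemma sqr_norm_mean (R : realType) (A : finZmodType) (f : A -> R[i]) :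
  `|mean f| ^+ 2 = mean (fun h => mean (mul_deriv h f)).
Proof.
rewrite normCK conj_mean mean_mulr mean_exchange; apply: eq_mean => x.
rewrite mean_mull !meanE; congr (_ * _).
by rewrite (reindex_inj (addrI x)).
Qed.

(** * Averaging along the fibers of a surjective homomorphism *)

Section Fibers.
Variables (R : realType) (A B : finZmodType) (tau : {additive A -> B}).
Hypothesis tau_surj : forall x, exists y, tau y = x.

(** Translation by [- z], for any [z] above [x], carries the fiber of [x] onto the kernel. *)
Lemma card_fiber x : #|[set y | tau y == x]| = #|[set y | tau y == 0%R]|.
Proof.
have [z tauz] := tau_surj x.
rewrite -(card_imset _ (addrI (- z))); apply: eq_card => y.
apply/imsetP/idP => [[t] | ].
  by rewrite !inE => /eqP taut ->; rewrite raddfD raddfN taut tauz addNr.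
rewrite inE => /eqP tauy; exists (z + y); last by rewrite addKr.
by rewrite inE raddfD tauy tauz addr0.
Qed.

Lemma fiber_gt0 x : (0 < #|[set y | tau y == x]|)%N.
Proof. by have [z tauz] := tau_surj x; apply/card_gt0P; exists z; rewrite inE tauz. Qed.

Lemma card_domain_fibers :
  #|A| = (#|B| * #|[set y | tau y == 0%R]|)%N.
Proof.
rewrite -[LHS]sum1_card [LHS](partition_big tau predT) //=.
rewrite -sum_nat_const; apply: eq_bigr => x _.
by rewrite -(card_fiber x) -sum1_card; apply: eq_bigl => y; rewrite inE.
Qed.

Lemma mean_fibers (F : A -> R[i]) :
  mean (fun x => avg [set y | tau y == x] F) = mean F.
Proof.
rewrite !meanE card_domain_fibers natrM invfM -mulrA; congr (_ * _).
rewrite [in RHS](partition_big tau predT) //= mulr_sumr.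
apply: eq_bigr => x _; rewrite /avg card_fiber; congr (_ * _).
by apply: eq_bigl => y; rewrite inE.
Qed.

(** On each fiber [f \o tau] is constant and can be moved inside the average. *)
Lemma mean_fiber_mul (f : B -> R[i]) (F : A -> R[i]) :
  mean (fun x => f x * avg [set y | tau y == x] F)
  = mean (fun y => f (tau y) * F y).
Proof.
rewrite -mean_fibers; apply: eq_mean => x; rewrite /avg mulrCA mulr_sumr.
by congr (_ * _); apply: eq_bigr => y; rewrite inE => /eqP ->.
Qed.

Lemma mean_comp (f : B -> R[i]) : mean (fun y => f (tau y)) = mean f.
Proof.
under eq_mean => y do rewrite -[f _]mulr1.
rewrite -mean_fiber_mul; apply: eq_mean => x.
rewrite /avg sumr_const mulVf ?mulr1 //.
by rewrite pnatr_eq0 -lt0n fiber_gt0.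
Qed.

End Fibers.

(** * Splitting off the first coordinate of a finite function *)

Section FfunCons.
Variables (T : finType) (d : nat).

Definition ffcons (t : T) (g : {ffun 'I_d -> T}) : {ffun 'I_d.+1 -> T} :=
  [ffun i => oapp g t (unlift ord0 i)].

Lemma ffcons0 t g : ffcons t g ord0 = t.
Proof. by rewrite ffunE unlift_none. Qed.

Lemma ffconsS t g i : ffcons t g (lift ord0 i) = g i.
Proof. by rewrite ffunE liftK. Qed.

Lemma ffcons_bij : bijective (fun p : T * {ffun 'I_d -> T} => ffcons p.1 p.2).
Proof.
exists (fun g : {ffun 'I_d.+1 -> T} => (g ord0, [ffun i => g (lift ord0 i)])).
  move=> [t g] /=; rewrite ffcons0; congr (_, _).
  by apply/ffunP => i; rewrite ffunE ffconsS.
move=> g; apply/ffunP => i; rewrite ffunE /=.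
by case: unliftP => [j ->|->] //=; rewrite ffunE.
Qed.

Lemma big_ffcons (S : Type) (idx : S) (op : Monoid.com_law idx)
    (F : {ffun 'I_d.+1 -> T} -> S) :
  \big[op/idx]_g F g = \big[op/idx]_t \big[op/idx]_g F (ffcons t g).
Proof.
rewrite (reindex _ (onW_bij _ ffcons_bij)) /=.
by rewrite pair_bigA.
Qed.

End FfunCons.

Lemma mean_ffcons (R : realType) (T : finType) (d : nat)
    (F : {ffun 'I_d.+1 -> T} -> R[i]) :
  mean F = mean (fun t => mean (fun g => F (ffcons t g))).
Proof.
rewrite !meanE !card_ffun !card_ord expnS natrM invfM -mulrA big_ffcons.
under [in RHS]eq_bigr => t _ do rewrite meanE card_ffun card_ord.
by rewrite -mulr_sumr.
Qed.

(** * Recursion for the Gowers averages *)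

Section Gowers.
Variables (R : realType) (Z : finZmodType).
Implicit Type f : Z -> R[i].

Lemma iter_conjM n (a b : R[i]) :
  iter n Num.conj (a * b) = iter n Num.conj a * iter n Num.conj b.
Proof. by elim: n => //= n ->; rewrite rmorphM. Qed.

Lemma gowers_avg0 f : gowers_avg 0 f = mean f.
Proof.
rewrite /gowers_avg mean_pair; apply: eq_mean => x.
have card1 (S : finType) : #|{: {ffun 'I_0 -> S}}| = 1%N.
  by rewrite card_ffun card_ord.
rewrite meanE card1 invr1 mul1r.
rewrite (eq_bigr (fun=> f x)) => [|h _].
  by rewrite sumr_const card1.
rewrite (eq_bigr (fun=> f x)) => [|v _].
  by rewrite prodr_const card1.
by rewrite /= !big_ord0 addr0.
Qed.

(** Single out the first direction [h]: the two cube vertices that differ only in the first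
    coordinate combine into one value of [mul_deriv h f]. *)
Lemma gowers_avgS d f :
  gowers_avg d.+1 f = mean (fun h => gowers_avg d (mul_deriv h f)).
Proof.
rewrite /gowers_avg mean_pair.
under eq_mean => x do rewrite mean_ffcons.
rewrite mean_exchange; apply: eq_mean => h; rewrite mean_pair.
apply: eq_mean => x; apply: eq_mean => g /=.
rewrite big_ffcons big_bool /= -big_split /=.
apply: eq_bigr => v _.
have weightE b : (\sum_(i < d) ffcons b v (lift ord0 i) = \sum_i v i)%N.
  by apply: eq_bigr => i _; rewrite ffconsS.
have shiftE b : \sum_(i < d) ffcons h g (lift ord0 i) *+ ffcons b v (lift ord0 i)
    = \sum_i g i *+ v i.
  by apply: eq_bigr => i _; rewrite !ffconsS.
(* The vertex with first coordinate [true] has one more conjugation; moved innermost by [iterSr], it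
   is the conjugation in [mul_deriv]. *)
rewrite !big_ord_recl !ffcons0 !weightE !shiftE /mul_deriv iter_conjM mulrC.
by rewrite add0n mulr0n add0r add1n iterSr mulr1n [h + _]addrC addrA.
Qed.

End Gowers.

(** * The exponential as a character of the circle *)

Section CircleExp.
Variable R : realType.

Lemma circle_exp0 : circle_exp (0 : circle R) = 1.
Proof.
rewrite (_ : 0 = \pi_(circle R)%qT 0); last by rewrite raddf0.
by rewrite circle_expE mulr0 cos0 sin0.
Qed.

Lemma circle_expD (s t : circle R) :
  circle_exp (s + t) = circle_exp s * circle_exp t.
Proof.
rewrite -[s]reprK -[t]reprK -raddfD !circle_expE mulrDr cosD sinD.
by apply/eqP; rewrite eq_complex /= eqxx /= [X in _ == X]addrC eqxx.
Qed.

Lemma circle_expN (t : circle R) :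
  circle_exp (- t) = Num.conj (circle_exp t).
Proof. by rewrite -[t]reprK -raddfN !circle_expE mulrN cosN sinN. Qed.

End CircleExp.

Lemma foldr_diff_opN (A B : zmodType) (P : A -> B) s x :
  foldr (@diff_op A B) (fun y => - P y) s x = - foldr (@diff_op A B) P s x.
Proof.
by elim: s x => //= h s IHs x; rewrite /diff_op !IHs opprB opprK addrC.
Qed.

(** * Correlation with a pulled-back phase, by induction on the degree *)

Section Correlation.
Variables (R : realType) (A B : finZmodType) (tau : {additive A -> B}).
Hypothesis tau_surj : forall x, exists y, tau y = x.

(** The sign of the new phase is negative because [mul_deriv] conjugates the shifted factor. *)
Lemma mul_deriv_phase h (f : B -> R[i]) (P : A -> circle R) y :
  mul_deriv h (fun y => f (tau y) * circle_exp (P y)) y =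
  mul_deriv (tau h) f (tau y) * circle_exp (- diff_op h P y).
Proof.
rewrite /mul_deriv /diff_op raddfD rmorphM /= -circle_expN mulrACA -circle_expD.
by rewrite opprB.
Qed.

Lemma correlation_le_gowers_avg d (f : B -> R[i]) (P : A -> circle R) :
  polynomial_map d P ->
  `|mean (fun y => f (tau y) * circle_exp (P y))| ^+ (2 ^ d.+1)
  <= gowers_avg d.+1 f.
Proof.
elim: d f P => [|d IHd] f P polP; rewrite gowers_avgS -(mean_comp tau_surj).
  rewrite expn1 sqr_norm_mean.
  (* In degree 0 the derivative of [P] vanishes, the phase becomes 1, and equality holds. *)
  rewrite le_eqVlt; apply/orP; left; apply/eqP; apply: eq_mean => h.
  rewrite gowers_avg0 -(mean_comp tau_surj); apply: eq_mean => y.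
  rewrite mul_deriv_phase.
  by rewrite [diff_op _ _ _](polP [tuple h]) oppr0 circle_exp0 mulr1.
rewrite expnS exprM sqr_norm_mean.
set c := fun h => mean _.
(* The values [c h] may be non-real, but their mean is a squared modulus, hence its own norm, so the
   triangle inequality applies. *)
have c_ge0 : 0 <= mean c by rewrite -sqr_norm_mean exprn_ge0.
have c_le : mean c <= mean (fun h => `|c h|).
  by rewrite -[leLHS]ger0_norm // ler_norm_mean.
apply: (@le_trans _ _ (mean (fun h => `|c h|) ^+ (2 ^ d.+1))).
  by apply: lerXn2r => //; exact: le_trans c_le.
apply: le_trans (mean_expr2X_le _ _) _ => //.
apply: ler_mean => h; rewrite /c.
under eq_mean => y do rewrite mul_deriv_phase.
apply: IHd => hs y; rewrite foldr_diff_opN.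
(* [foldr] applies the last entry first, so appending [h] at the end turns differences of
   [diff_op h P] into differences of [P]. *)
by have := polP [tuple of rcons hs h] y; rewrite /= foldr_rcons => ->; rewrite oppr0.
Qed.

End Correlation.

Theorem proposition5p5 (R : realType) (k : nat) (Z : finZmodType)
    (psi f : Z -> R[i]) (delta : R) :
  projected_phase_polynomial k psi ->
  0 < delta ->
  delta%:C <= `|inner f psi| ->
  delta%:C <= gowers_norm k.+1 f.
Proof.
move=> [_ [Z' [tau [phi [tau_surj [P polP ->] psiE]]]]] delta_gt0 le_delta.
have delta_ge0 : 0 <= delta%:C :> R[i] by rewrite ler0c ltW.
have two_gt0 : (0 < 2 ^ k.+1)%N by rewrite expn_gt0.
(* [inner] conjugates [psi], which negates the phase. *)
pose Q y := - P y.
have innerE : inner f psi = mean (fun y => f (tau y) * circle_exp (Q y)).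
  rewrite -(mean_fiber_mul tau_surj); apply: eq_mean => x.
  rewrite psiE /avg rmorphM fmorphV rmorph_nat rmorph_sum; congr (_ * (_ * _)).
  by apply: eq_bigr => y _; rewrite circle_expN.
have polQ : polynomial_map k Q.
  by move=> hs x; rewrite foldr_diff_opN polP oppr0.
have corr := correlation_le_gowers_avg tau_surj f polQ.
have delta_le : delta%:C ^+ (2 ^ k.+1) <= gowers_avg k.+1 f.
  apply: le_trans corr; rewrite -innerE.
  by rewrite lerXn2r // nnegrE (le_trans delta_ge0).
have pow_ge0 : 0 <= delta%:C ^+ (2 ^ k.+1) by rewrite exprn_ge0.
(* Writing [delta%:C] as the root of its own power reduces the claim to monotonicity of roots on
   nonnegative elements. *)
rewrite /gowers_norm -(exprCK two_gt0 delta_ge0).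
by rewrite ler_rootC // nnegrE (le_trans pow_ge0).
Qed.
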